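(* For every fixed monotone forest $F$, $sat_m(n,e_0+F)=O(1)$.
   Context: An edge-ordered graph is a finite simple graph together with a linear order on its edge set (usually given by an injective labeling $l:E\to\mathbb{N}$ or $l:E\to\mathbb{R}$). An edge-ordered graph $H$ contains $G$ (has a copy of $G$) if $G$ is isomorphic, by an isomorphism respecting the edge-order, to a subgraph of $H$ with the induced order; otherwise $H$ is $G$-free. $l(F_1)<l(F_2)$ means that all labels of edges of $F_1$ are smaller than all labels of edges of $F_2$. A monotone forest is an edge-ordered graph $F=\sum_{i=1}^k T_i$ that is the vertex-disjoint union of edge-ordered trees $T_1,\dots,T_k$ with $l(T_i)<l(T_j)$ for all $1\le i<j\le k$. For an edge-ordered graph $G$, $e_0+G$ denotes the edge-ordered graph obtained from $G$ by adding a vertex-disjoint (isolated) edge $e_0$ whose label is smaller than all labels of $G$. $sat_m(n,G)$ is the minimum number of edges in a $G$-free edge-ordered graph $H$ on $n$ vertices such that adding to $H$ any missing edge, inserted at the beginning of the linear order (i.e. with a label smaller than all labels of $H$), creates a copy of $G$. Asymptotic notation is for $n\to\infty$ with $F$ fixed. *)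

(* Defs.v *)
From mathcomp Require Import all_boot.

Set Implicit Arguments.
Unset Strict Implicit.
Unset Printing Implicit Defensive.

(* Edges are two-element vertex sets. The edge order is given by an injective
   labelling by natural numbers; [label] is only meaningful on [edges]. *)
Record eograph (V : finType) := EOGraph {
  edges : {set {set V}};
  label : {set V} -> nat;
  edges_card2 : forall e, e \in edges -> #|e| = 2;
  label_inj : {in edges &, injective label}
}.

Section Construct.
Variable V : finType.

(* Old labels are shifted by one to make room for the new smallest label 0. *)
Definition add_first_label (G : eograph V) (e f : {set V}) : nat :=
  if f == e then 0 else (label G f).+1.

Fact add_first_card2 (G : eograph V) (e : {set V}) (e2 : #|e| = 2) f :
  f \in e |: edges G -> #|f| = 2.
Proof. by case/setU1P=> [-> // | /edges_card2]. Qed.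

Fact add_first_inj (G : eograph V) (e : {set V}) :
  {in e |: edges G &, injective (add_first_label G e)}.
Proof.
move=> f g /setU1P fG /setU1P gG; rewrite /add_first_label.
case: (f =P e) fG => [-> _|ne_fe [//|fG]]; case: (g =P e) gG => [-> //|ne_ge [//|gG]] //.
by case=> /label_inj->.
Qed.

Definition add_first (G : eograph V) (e : {set V}) (e2 : #|e| = 2) : eograph V :=
  EOGraph (add_first_card2 (G := G) e2) (@add_first_inj G e).

End Construct.

Section Transfer.
Variables V W : finType.

Fact copy_card2 (h : V -> W) (h_inj : injective h) (G : eograph V) e :
  e \in (fun d : {set V} => h @: d) @: edges G -> #|e| = 2.
Proof. by case/imsetP=> d dG ->; rewrite card_imset // (edges_card2 dG). Qed.

Fact copy_label_inj (h : V -> W) (h_inj : injective h) (G : eograph V) :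
  {in (fun d : {set V} => h @: d) @: edges G &,
    injective (fun e : {set W} => label G (h @^-1: e))}.
Proof.
have hK (d : {set V}) : h @^-1: (h @: d) = d.
  by apply/setP=> x; rewrite inE mem_imset.
move=> _ _ /imsetP[d dG ->] /imsetP[d' d'G ->]; rewrite !hK.
by move/label_inj=> ->.
Qed.

(* The copy of G on the image of h; vertices outside the image are isolated. *)
Definition copy (h : V -> W) (h_inj : injective h) (G : eograph V) : eograph W :=
  EOGraph (copy_card2 h_inj (G := G)) (copy_label_inj h_inj (G := G)).

Fact induced_card2 (h : W -> V) (h_inj : injective h) (G : eograph V) e :
  e \in [set d : {set W} | h @: d \in edges G] -> #|e| = 2.
Proof. by rewrite inE => /edges_card2; rewrite card_imset. Qed.

Fact induced_label_inj (h : W -> V) (h_inj : injective h) (G : eograph V) :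
  {in [set d : {set W} | h @: d \in edges G] &,
    injective (fun d : {set W} => label G (h @: d))}.
Proof.
move=> d d'; rewrite !inE => dG d'G /label_inj eq_h.
exact: (imset_inj h_inj (eq_h dG d'G)).
Qed.

End Transfer.

Definition induced (V : finType) (G : eograph V) (S : {set V}) :
    eograph {x : V | x \in S} :=
  EOGraph (induced_card2 (@val_inj _ _ _) (G := G))
          (induced_label_inj (@val_inj _ _ _) (G := G)).

(* f is an order-preserving isomorphism from G onto the (not necessarily
   induced) subgraph of H with vertex set f(V) and edge set f(E(G)). *)
Definition contains (W V : finType) (H : eograph W) (G : eograph V) : Prop :=
  exists f : V -> W,
    [/\ injective f,
        forall e, e \in edges G -> f @: e \in edges H
      & {in edges G &, forall d e,
          label G d < label G e -> label H (f @: d) < label H (f @: e)}].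

Definition adj (V : finType) (G : eograph V) : rel V :=
  fun x y => [set x; y] \in edges G.

Definition is_tree (V : finType) (T : eograph V) : Prop :=
  [/\ 0 < #|V|,
      forall x y, connect (adj T) x y
    & forall p : seq V, 2 < size p -> ~ ucycle (adj T) p].

Definition label_lt (V W : finType) (G : eograph V) (H : eograph W) : Prop :=
  forall d e, d \in edges G -> e \in edges H -> label G d < label H e.

(* The fibres of c are the vertex sets of the trees T_1, ..., T_k. *)
Definition monotone_forest (V : finType) (F : eograph V) : Prop :=
  exists (k : nat) (c : V -> 'I_k),
    let T (i : 'I_k) := induced F [set x | c x == i] in
    [/\ forall i, is_tree (T i),
        forall x y, adj F x y -> c x = c y
      & forall i j : 'I_k, i < j -> label_lt (T i) (T j)].

Definition new_edge (V : finType) : {set bool + V} := [set inl true; inl false].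

Fact new_edge_card2 (V : finType) : #|new_edge V| = 2.
Proof. by rewrite cards2. Qed.

(* The edge-ordered graph e_0 + G; e_0 joins the two vertices coming from bool. *)
Definition e0_plus (V : finType) (G : eograph V) : eograph (bool + V)%type :=
  add_first (copy (@inr_inj bool V) G) (new_edge_card2 V).

Definition saturated (n : nat) (V : finType) (G : eograph V)
    (H : eograph 'I_n) : Prop :=
  ~ contains H G /\
  forall (e : {set 'I_n}) (e2 : #|e| = 2),
    e \notin edges H -> contains (add_first H e2) G.

(* sat_m n G m states that the minimum sat_m(n, G) exists and is equal to m. *)
Definition sat_m (n : nat) (V : finType) (G : eograph V) (m : nat) : Prop :=
  (exists2 H : eograph 'I_n, saturated G H & #|edges H| = m) /\
  forall H : eograph 'I_n, saturated G H -> m <= #|edges H|.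

(* Main.v *)
Require Import Defs.
From mathcomp Require Import all_boot zify.
From Stdlib Require Import Classical_Prop.

(** It suffices to find one finite edge-ordered graph H that has no e_0 + F but
    keeps a copy of F after the removal of any single vertex: place H among
    isolated vertices and greedily add missing edges, each with the smallest
    label, as long as no e_0 + F appears.  A missing edge with an endpoint
    outside H always creates e_0 + F, so only edges inside H are ever added, and
    the number of edges is bounded independently of n.

    For a tree T with smallest edge xy, let T/xy be the contraction of xy.  Take
    three disjoint copies of T/xy and join the three contracted vertices by a
    triangle carrying the smallest labels.  Deleting a copy leaves T: one
    remaining copy supplies the x-side of T, the other the y-side, and a
    triangle edge supplies xy.  A copy of T after and disjoint from an edge e
    cannot use triangle edges (if it did, e would be one too, and any two of
    them meet), so it would lie in one copy of T/xy, which has one edge too few.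
    For a monotone forest, take these graphs for all its trees, with labels in
    the order of the trees; e_0 + F is excluded by downward induction on the
    index of the component that contains the image of e_0. *)

Set Implicit Arguments.
Unset Strict Implicit.
Unset Printing Implicit Defensive.

(** * Order embeddings and elementary facts on edges *)

(** Injectivity is left out because [copy_not_contains] recovers a map that is arbitrary on isolated
    vertices of [F]. *)
Definition order_embedding (V W : finType) (G : eograph V) (H : eograph W)
    (f : V -> W) : Prop :=
  (forall e, e \in edges G -> f @: e \in edges H) /\
  {in edges G &, forall d e,
     label G d < label G e -> label H (f @: d) < label H (f @: e)}.

Lemma edgeP (V : finType) (G : eograph V) e :
  e \in edges G -> exists x y, [/\ x != y, e = [set x; y] & adj G x y].
Proof.
move=> eG; have /eqP/cards2P[x [y [xy def_e]]] := edges_card2 eG.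
by exists x, y; rewrite /adj -def_e.
Qed.

Lemma adj_sym (V : finType) (G : eograph V) : symmetric (adj G).
Proof. by move=> x y; rewrite /adj setUC. Qed.

Lemma adj_neq (V : finType) (G : eograph V) x y : adj G x y -> x != y.
Proof. by move=> /edges_card2; rewrite cards2; case: eqP. Qed.

Lemma edge_set2 (V : finType) (G : eograph V) e x y :
  e \in edges G -> x \in e -> y \in e -> x != y -> e = [set x; y].
Proof.
move=> eG xe ye xy; apply/esym/eqP; rewrite eqEcard (edges_card2 eG) cards2 xy.
by rewrite andbT; apply/subsetP=> z /set2P[] ->.
Qed.

Lemma adj_edge (V : finType) (G : eograph V) e x y :
  e \in edges G -> x \in e -> y \in e -> x != y -> adj G x y.
Proof. by move=> eG xe ye xy; rewrite /adj -(edge_set2 eG xe ye xy). Qed.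

Lemma path_constant (V : finType) (T : eqType) (e : rel V) (P : pred V)
    (q : V -> T) :
  (forall x y, P x -> e x y -> P y /\ q x = q y) ->
  forall x y, P x -> connect e x y -> P y /\ q x = q y.
Proof.
move=> eq_q x y Px /connectP[p]; elim: p x Px => [|z p IHp] x Px /=.
  by move=> _ ->.
by case/andP=> /(eq_q _ _ Px)[Pz ->] /IHp; apply.
Qed.

(** * Components of a monotone forest, seen as fibres of [c] *)

Section Forest.

Variables (V : finType) (F : eograph V) (k : nat) (c : V -> 'I_k).
Hypothesis hT : forall i, is_tree (induced F [set x | c x == i]).
Hypothesis adj_c : forall x y, adj F x y -> c x = c y.
Hypothesis hlt : forall i j : 'I_k, i < j ->
  label_lt (induced F [set x | c x == i]) (induced F [set x | c x == j]).

Lemma fibre_connected x y : c x = c y -> connect (adj F) x y.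
Proof.
move=> cxy; have [_ conn _] := hT (c y).
have xP : x \in [set z | c z == c y] by rewrite inE cxy.
have yP : y \in [set z | c z == c y] by rewrite inE.
have /connectP[p pth lst] := conn (exist _ x xP) (exist _ y yP).
apply/connectP.
rewrite -[x]/(val (exist (fun z => z \in [set z | c z == c y]) x xP)).
exists (map val p); last by rewrite last_map -lst.
apply: homo_path pth => a b; rewrite /adj inE.
by rewrite imsetU1 imset_set1.
Qed.

(** Edges preserve [c], so a cycle stays in one fibre and lifts to the tree there. *)
Lemma fibre_acyclic p : 2 < size p -> ~ ucycle (adj F) p.
Proof.
case: p => // x p szp /andP[cyc uni].
have [_ _ acyc] := hT (c x).
have allc : all (fun y => y \in [set z | c z == c x]) (x :: p).
  rewrite /= inE eqxx /=; move: cyc; rewrite /= rcons_path => /andP[+ _].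
  elim: p x {szp uni acyc} => //= y p IHp x /andP[/adj_c cxy /IHp].
  by rewrite inE cxy eqxx.
have [s def_s] := all_sigP allc.
apply: (acyc s); first by rewrite -(size_map val) -def_s.
apply/andP; split; last by rewrite -(map_inj_uniq val_inj) -def_s.
move: cyc; rewrite def_s cycle_map; congr is_true; apply: eq_cycle => a b.
by rewrite /adj /= inE imsetU1 imset_set1.
Qed.

Lemma edge_c d x y : d \in edges F -> x \in d -> y \in d -> c x = c y.
Proof.
move=> dF xd yd; have [->//|] := eqVneq x y.
by move/(adj_edge dF xd yd)/adj_c.
Qed.

Lemma edge_fibre d x : d \in edges F -> x \in d ->
  exists2 d', d' \in edges (induced F [set z | c z == c x]) & val @: d' = d.
Proof.
move=> dF xd.
pose d' := [set z : {z | z \in [set z | c z == c x]} | val z \in d].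
suff eq_d : val @: d' = d by exists d'; rewrite // inE eq_d.
apply/setP=> y; apply/imsetP/idP=> [[z + ->]|yd]; first by rewrite inE.
have yP : y \in [set z | c z == c x] by rewrite inE (edge_c dF yd xd).
by exists (exist _ y yP); rewrite ?inE.
Qed.

Lemma fibre_monotone d e x y :
  d \in edges F -> e \in edges F -> x \in d -> y \in e -> c x < c y ->
  label F d < label F e.
Proof.
move=> dF eF xd ye cxy.
have [d' d'F <-] := edge_fibre dF xd; have [e' e'F <-] := edge_fibre eF ye.
exact: (hlt cxy d'F e'F).
Qed.

Lemma min_edge_exists i : exists p : V * V,
  [/\ c p.1 = i, c p.2 = i & forall d x, d \in edges F -> x \in d -> c x = i ->
      [set p.1; p.2] \in edges F /\ label F [set p.1; p.2] <= label F d].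
Proof.
pose E := [pred d | (d \in edges F) && [exists x in d, c x == i]].
have [d0 Ed0|noE] := pickP E; last first.
  have [/card_gt0P[[x xP] _] _ _] := hT i.
  have cx : c x = i by move: xP; rewrite inE => /eqP.
  (* A tree without edges still has a vertex, which serves as both endpoints; the minimality clause
     is then vacuous. *)
  exists (x, x); split=> // d y dF yd cy.
  have := noE d; rewrite /= dF; case: exists_inP => // -[].
  by exists y; rewrite ?cy.
case: (arg_minnP (label F) Ed0) => d /andP[dF /exists_inP[x xd /eqP cx]] dmin.
have [a [b [_ def_d ab]]] := edgeP dF; exists (a, b); rewrite /= -def_d.
split; rewrite -?cx;
  try by apply: (edge_c dF); rewrite // def_d !inE eqxx ?orbT.
move=> e y eF ye cy; split=> //; apply: dmin; rewrite /= eF /=.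
by apply/exists_inP; exists y; rewrite ?cy ?cx.
Qed.

End Forest.

(** * The gadget: three contracted copies joined by triangles *)

Lemma ordS3_neq (j : 'I_3) : ordS j != j.
Proof. by case: j => [[|[|[|//]]] ?]. Qed.

Lemma ordS3_ordS3_neq (j : 'I_3) : ordS (ordS j) != j.
Proof. by case: j => [[|[|[|//]]] ?]. Qed.

(** Any two edges of the triangle, from [j] to [j + 1] and from [j'] to [j' + 1], share a vertex. *)
Lemma ordS3_cover (j j' : 'I_3) : [|| j' == j, j' == ordS j | j == ordS j'].
Proof. by case: j j' => [[|[|[|//]]] ?] [[|[|[|//]]] ?]. Qed.

Section Gadget.

Variables (V : finType) (F : eograph V) (k : nat) (c : V -> 'I_k).
Hypothesis connF : forall x y, c x = c y -> connect (adj F) x y.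
Hypothesis acyclicF : forall p, 2 < size p -> ~ ucycle (adj F) p.
Hypothesis edge_c : forall d x y,
  d \in edges F -> x \in d -> y \in d -> c x = c y.
Hypothesis monoF : forall d e x y,
  d \in edges F -> e \in edges F -> x \in d -> y \in e -> c x < c y ->
  label F d < label F e.

(* X i = Y i is allowed when the i-th tree is a single vertex. *)
Variables X Y : 'I_k -> V.
Hypotheses (cX : forall i, c (X i) = i) (cY : forall i, c (Y i) = i).
Hypothesis minXY : forall d x, d \in edges F -> x \in d ->
  [set X (c x); Y (c x)] \in edges F /\
  label F [set X (c x); Y (c x)] <= label F d.

Let W : finType := ('I_3 * V)%type.

Lemma adj_c x y : adj F x y -> c x = c y.
Proof. by move=> xy; apply: (edge_c xy); rewrite !inE eqxx ?orbT. Qed.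

Definition min_edge (d : {set V}) := [exists i, d == [set X i; Y i]].

Lemma min_edgeE d x : d \in edges F -> x \in d ->
  min_edge d = (d == [set X (c x); Y (c x)]).
Proof.
move=> dF xd; apply/existsP/eqP=> [[i /eqP def_d]|->]; last by exists (c x).
by move: xd; rewrite def_d => /set2P[] ->; rewrite ?cX ?cY.
Qed.

(** A path from [X i] to [Y i] supplies some edge in the tree, so [minXY] applies. *)
Lemma XY_edge i : X i != Y i -> [set X i; Y i] \in edges F.
Proof.
have /connF/connectP[[|z p] /= pth eqY] : c (X i) = c (Y i) by rewrite cX cY.
  by rewrite eqY eqxx.
by case/andP: pth => /minXY/(_ (set21 _ _))[]; rewrite cX.
Qed.

Lemma min_edge_XY i : min_edge [set X i; Y i].
Proof. by apply/existsP; exists i. Qed.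

Lemma min_edgeP d : d \in edges F -> min_edge d ->
  exists i, [/\ d = [set X i; Y i], X i != Y i & forall x, x \in d -> c x = i].
Proof.
move=> dF /existsP[i /eqP def_d]; exists i; split=> //.
  by apply: (@adj_neq _ F); rewrite /adj -def_d.
by move=> x; rewrite def_d => /set2P[] ->; rewrite ?cX ?cY.
Qed.

(** The contracted tree stays on the type [V]: [Y i] is merged into [X i], and its own copies become
    isolated vertices of the gadget. *)
Definition contract (u : V) := if u == Y (c u) then X (c u) else u.

Lemma contractX i : contract (X i) = X i.
Proof. by rewrite /contract cX; case: eqP. Qed.

Lemma contractY i : contract (Y i) = X i.
Proof. by rewrite /contract cY eqxx. Qed.

Lemma c_contract u : c (contract u) = c u.
Proof. by rewrite /contract; case: eqP; rewrite ?cX. Qed.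

Lemma contract_eq u v : contract u = contract v -> u != v ->
  [set u; v] = [set X (c u); Y (c u)].
Proof.
move=> eq_r uv; have cuv : c u = c v by rewrite -c_contract eq_r c_contract.
move: eq_r; rewrite /contract -cuv.
case: (u =P Y (c u)) => [eu|_]; case: (v =P Y (c u)) => [ev|_] // eq_r.
- by case/eqP: uv; rewrite eu ev.
- by rewrite -eu eq_r setUC.
- by rewrite -eq_r ev.
- by case/eqP: uv.
Qed.

(* For a non-minimal edge d this is the j-th copy of d in the contraction; for
   d = [set X i; Y i] it is the triangle edge from copy j to copy j + 1. *)
Definition place (j : 'I_3) (d : {set V}) : {set W} :=
  [set (if min_edge d && (u == Y (c u)) then ordS j else j, contract u)
     | u in d].

Lemma place_min j i : X i != Y i ->
  place j [set X i; Y i] = [set (j, X i); (ordS j, X i)].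
Proof.
move=> XY; rewrite /place imsetU1 imset_set1 min_edge_XY cX cY eqxx (negbTE XY).
by rewrite contractX contractY.
Qed.

Lemma place_nonmin j d : ~~ min_edge d ->
  place j d = [set (j, contract u) | u in d].
Proof. by move/negbTE=> nm; apply: eq_imset => u; rewrite nm. Qed.

Lemma place_c j d x p : d \in edges F -> x \in d -> p \in place j d ->
  c p.2 = c x.
Proof.
by move=> dF xd /imsetP[u ud ->]; rewrite /= c_contract (edge_c dF ud xd).
Qed.

Lemma place_card2 j d : d \in edges F -> #|place j d| = 2.
Proof.
move=> dF; have [md|nm] := boolP (min_edge d).
  have [i [-> XY _]] := min_edgeP dF md.
  by rewrite place_min // cards2 xpair_eqE eq_sym (negbTE (ordS3_neq j)).
rewrite place_nonmin // card_in_imset ?(edges_card2 dF) // => u v ud vd [] eq_r.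
apply: contraNeq nm => uv; rewrite (min_edgeE dF ud) -(contract_eq eq_r uv).
by rewrite -(edge_set2 dF ud vd uv).
Qed.

Lemma triangle_free x y z : adj F x y -> adj F y z -> adj F z x -> False.
Proof.
move=> xy yz zx; apply: (@acyclicF [:: x; y; z]) => //.
rewrite /ucycle /= xy yz zx !inE negb_or (adj_neq xy) (adj_neq yz).
by rewrite eq_sym (adj_neq zx).
Qed.

(** This makes the gadget labelling well defined. Triangle edges join two copies and the others stay
    inside one. Two edges of a tree with the same contraction either close a triangle with the
    contracted edge or are both equal to it. *)
Lemma place_inj j j' d d' : d \in edges F -> d' \in edges F ->
  place j d = place j' d' -> j = j' /\ d = d'.
Proof.
(* By symmetry, if exactly one of the two edges is minimal, it is [d']. *)
move=> dF d'F; wlog md' : j j' d d' dF d'F / min_edge d -> min_edge d'.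
  have [md'|nm'] := boolP (min_edge d').
    by move=> H; apply: H.
  by move=> H /esym/(H _ _ _ _ d'F dF)[/(negP nm')//|-> ->].
have [md|nm] := boolP (min_edge d) => eq_p.
  have [i [def_d XY _]] := min_edgeP dF md.
  have [i' [def_d' XY' _]] := min_edgeP d'F (md' md).
  move: eq_p; rewrite def_d def_d' !place_min // => eq_p.
  have : (j, X i) \in [set (j', X i'); (ordS j', X i')] by rewrite -eq_p set21.
  have : (ordS j, X i) \in [set (j', X i'); (ordS j', X i')].
    by rewrite -eq_p set22.
  rewrite !inE !xpair_eqE => H1 H2.
  have ii' : i = i'.
    by rewrite -[i]cX -[i']cX; congr c; case/orP: H1 => /andP[_ /eqP].
  (* If [j = ordS j'], then [ordS j] is the third index, which is not an endpoint of the triangle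
     edge starting at [j']. *)
  rewrite ii'; split=> //; case/orP: H2 => /andP[/eqP-> _] // in H1 *.
  have := ordS3_ordS3_neq j'; have := ordS3_neq (ordS j').
  by case/orP: H1 => /andP[/eqP-> _]; rewrite eqxx.
have [m'|nm'] := boolP (min_edge d').
  have [i [def_d' XY _]] := min_edgeP d'F m'.
  move: eq_p; rewrite def_d' place_min // place_nonmin // => eq_p.
  have : (j', X i) \in [set (j, contract u) | u in d] by rewrite eq_p set21.
  have : (ordS j', X i) \in [set (j, contract u) | u in d].
    by rewrite eq_p set22.
  move=> /imsetP[u _ [<- _]] /imsetP[v _ [/esym/eqP]].
  by rewrite (negbTE (ordS3_neq _)).
have [u [v [uv def_d aduv]]] := edgeP dF.
move: eq_p; rewrite !place_nonmin // => eq_p.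
have partner w : w \in d ->
    j = j' /\ exists2 w', w' \in d' & contract w = contract w'.
  move=> wd; have : (j, contract w) \in [set (j', contract u) | u in d'].
    by rewrite -eq_p imset_f.
  by case/imsetP=> w' w'd' [-> ->]; split=> //; exists w'.
have [ud vd] : u \in d /\ v \in d by rewrite def_d set21 set22.
have [jj' [u' u'd' ru]] := partner u ud; have [_ [v' v'd' rv]] := partner v vd.
split=> //.
have cuv : c u = c v by apply: (edge_c dF).
have nadj a b (x : {set V}) :
    a \in x -> b \in x -> x \in edges F -> ~~ min_edge x ->
    contract a != contract b \/ a = b.
  move=> ax bx xF nmx; have [->|ab] := eqVneq a b; [by right | left].
  apply: contraNneq nmx => rab; rewrite (min_edgeE xF ax) -(contract_eq rab ab).
  by rewrite -(edge_set2 xF ax bx ab).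
have u'v' : u' != v'.
  apply: contraNneq uv => u'v'.
  by case: (nadj u v d) => //; [rewrite ru rv u'v' eqxx | move->].
have def_d' : d' = [set u'; v'].
  exact: (edge_set2 d'F).
have ad' : adj F u' v' by rewrite /adj -def_d'.
have XYadj a b : contract a = contract b -> a != b -> adj F a b.
  move=> rab ab; rewrite /adj (contract_eq rab ab); apply: XY_edge.
  apply: contraNneq (ab) => XY.
  have := set21 a b; have := set22 a b; rewrite (contract_eq rab ab) XY setUid.
  by move=> /set1P-> /set1P ea; apply/eqP.
(* One common endpoint gives a triangle in [F]; none forces both [{u, u'}] and [{v, v'}] to be the
   minimal edge, hence also [d]. *)
have [uu'|nuu'] := eqVneq u u'; have [vv'|nvv'] := eqVneq v v'.
- by rewrite def_d def_d' uu' vv'.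
- case: (@triangle_free u v v') => //; first exact: XYadj.
  by rewrite uu' adj_sym.
- case: (@triangle_free v u u') => //; [by rewrite adj_sym | exact: XYadj |].
  by rewrite vv'.
- case/negP: nm; rewrite (min_edgeE dF ud) def_d.
  have := contract_eq ru nuu'; rewrite cuv -(contract_eq rv nvv') => eq_uv.
  have : u \in [set v; v'] by rewrite -eq_uv set21.
  by rewrite !inE (negbTE uv) /= => /eqP->; rewrite setUC.
Qed.

Definition gadget_edges : {set {set W}} :=
  [set place p.1 p.2 | p in [set p : 'I_3 * {set V} | p.2 \in edges F]].

(** The three images of an edge get consecutive labels, and the factor 3 keeps the order of [F]
    between different edges whatever the copies. The [pick] inverts [place]; the value 0 is only
    taken off the edges. *)
Definition gadget_label (D : {set W}) : nat :=
  if [pick p : 'I_3 * {set V} | (p.2 \in edges F) && (place p.1 p.2 == D)]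
    is Some p then 3 * label F p.2 + p.1 else 0.

Lemma gadget_edgeP D : D \in gadget_edges ->
  exists j d, d \in edges F /\ D = place j d.
Proof. by case/imsetP=> -[j d] /[!inE] /= dF ->; exists j, d. Qed.

Lemma place_edge j d : d \in edges F -> place j d \in gadget_edges.
Proof. by move=> dF; apply/imsetP; exists (j, d); rewrite ?inE. Qed.

Lemma gadget_labelE j d : d \in edges F ->
  gadget_label (place j d) = 3 * label F d + j.
Proof.
move=> dF; rewrite /gadget_label; case: pickP => [[j' d'] /=|/(_ (j, d))].
  by case/andP=> d'F /eqP/(place_inj d'F dF)[-> ->].
by rewrite /= dF eqxx.
Qed.

Fact gadget_card2 D : D \in gadget_edges -> #|D| = 2.
Proof. by case/gadget_edgeP=> j [d [dF ->]]; apply: place_card2. Qed.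

Fact gadget_label_inj : {in gadget_edges &, injective gadget_label}.
Proof.
move=> _ _ /gadget_edgeP[j [d [dF ->]]] /gadget_edgeP[j' [d' [d'F ->]]].
rewrite !gadget_labelE // => eq_l.
have jlt := ltn_ord j; have j'lt := ltn_ord j'.
have -> : d = d' by apply: (label_inj dF d'F); lia.
by have -> : j = j' by apply: ord_inj; lia.
Qed.

Definition gadget : eograph W := EOGraph gadget_card2 gadget_label_inj.

(** * Embedding [F] while avoiding one copy *)

Definition adj_nonmin : rel V := fun a b => adj F a b && ~~ min_edge [set a; b].

(** True on the part of the tree that contains [X (c u)] once the minimal edge is removed. *)
Definition side u := connect adj_nonmin (X (c u)) u.

(** A simple path avoiding the minimal edge would close up with it to a cycle; such a path has at
    least two edges, since a single one would be the minimal edge itself. *)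
Lemma min_edge_bridge i : X i != Y i -> ~~ connect adj_nonmin (X i) (Y i).
Proof.
move=> XY; apply/connectP=> -[p pth eqY]; move: pth eqY.
case/shortenP=> q pth uni _ eqY; apply: (@acyclicF (X i :: q)).
  case: q pth uni eqY => [|z [|z' q]] //= pth _ eqY.
    by rewrite eqY eqxx in XY.
  by move: pth; rewrite -eqY /adj_nonmin min_edge_XY andbF.
rewrite /ucycle uni andbT /= rcons_path -eqY adj_sym.
rewrite [X in _ && X]XY_edge // andbT.
by apply: sub_path pth => a b /andP[].
Qed.

Lemma adj_nonmin_side a b : adj_nonmin a b -> side a = side b.
Proof.
move=> ab; have [/adj_c cab _] := andP ab; rewrite /side cab.
apply: same_connect_r (connect1 ab) _.
by apply: sym_connect_sym => x y; rewrite /adj_nonmin adj_sym setUC.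
Qed.

Lemma gadget_embedding j0 : exists f : V -> W,
  [/\ injective f, order_embedding F gadget f & forall u, (f u).1 != j0].
Proof.
(* The [X]-side must go to the first of the two copies, because [place] directs triangle edges from
   [X i] in copy [j] to [Y i] in copy [j + 1]. *)
pose f u : W := (if side u then ordS j0 else ordS (ordS j0), contract u).
have sideX i : side (X i) by rewrite /side cX.
have sideY i : X i != Y i -> side (Y i) = false.
  by move=> XY; rewrite /side cY; apply/negbTE/min_edge_bridge.
have f_place d : d \in edges F -> exists j, f @: d = place j d.
  move=> dF; have [md|nm] := boolP (min_edge d).
    have [i [-> XY _]] := min_edgeP dF md; exists (ordS j0).
    rewrite place_min // imsetU1 imset_set1 /f sideX sideY //.
    by rewrite contractX contractY.
  have [u [v [_ def_d uv]]] := edgeP dF.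
  exists (if side u then ordS j0 else ordS (ordS j0)).
  have eq_s : side u = side v.
    by apply: adj_nonmin_side; rewrite /adj_nonmin uv -def_d.
  by rewrite place_nonmin // def_d !imsetU1 !imset_set1 /f eq_s.
exists f; split.
(* Only the endpoints of a minimal edge share a contraction, and they lie on opposite sides. *)
- move=> u v [eq_s eq_r]; have [//|uv] := eqVneq u v.
  have [i [def_uv XY]] : exists i, [set u; v] = [set X i; Y i] /\ X i != Y i.
    exists (c u); have def_uv := contract_eq eq_r uv; split=> //.
    have := cards2 (X (c u)) (Y (c u)).
    by rewrite -def_uv cards2 uv; case: (_ != _).
  have neqS : (ordS j0 == ordS (ordS j0)) = false.
    by rewrite eq_sym (negbTE (ordS3_neq _)).
  have := set21 u v; have := set22 u v; rewrite def_uv.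
  case/set2P=> ev /set2P[] eu //; rewrite ?eu ?ev // in uv eq_s *.
  + by move/eqP: eq_s; rewrite sideX sideY // eq_sym neqS.
  + by move/eqP: eq_s; rewrite sideX sideY // neqS.
- split=> [d dF|d e dF eF lt_de].
    by have [j ->] := f_place d dF; apply: place_edge.
  have [j ->] := f_place d dF; have [j' ->] := f_place e eF.
  by rewrite /= !gadget_labelE //; have := ltn_ord j; lia.
- by move=> u /=; case: ifP => _; rewrite ?ordS3_neq ?ordS3_ordS3_neq.
Qed.

(** * Excluding [e_0 + F] from the gadget *)

Lemma gadget_monotone D D' p p' :
  D \in edges gadget -> D' \in edges gadget -> p \in D -> p' \in D' ->
  c p.2 < c p'.2 -> label gadget D < label gadget D'.
Proof.
move=> /gadget_edgeP[j [d [dF ->]]] /gadget_edgeP[j' [d' [d'F ->]]] pD p'D'.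
have [x [x' [_ dx _]]] := edgeP dF; have [y [y' [_ dy _]]] := edgeP d'F.
have [xd yd'] : x \in d /\ y \in d' by rewrite dx dy !set21.
rewrite (place_c dF xd pD) (place_c d'F yd' p'D') /= !gadget_labelE //.
move/(monoF dF d'F xd yd'); have := ltn_ord j; lia.
Qed.

Lemma gadget_edge_c D p q : D \in edges gadget -> p \in D -> q \in D ->
  c p.2 = c q.2.
Proof.
move=> /gadget_edgeP[j [d [dF ->]]] pD qD.
have [x [y [_ dx _]]] := edgeP dF; have xd : x \in d by rewrite dx set21.
by rewrite (place_c dF xd pD) (place_c dF xd qD).
Qed.

Lemma embedding_adj (g : V -> W) x y : order_embedding F gadget g ->
  adj F x y -> adj gadget (g x) (g y).
Proof. by move=> [gE _] /gE; rewrite imsetU1 imset_set1. Qed.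

(** No image of an edge of the [i]-th tree is a triangle edge, so by connectivity all of them lie in
    one copy of the contraction, which has one edge fewer than the tree. *)
Lemma no_fibre_after (g : V -> W) (i : 'I_k) D : order_embedding F gadget g ->
  D \in edges gadget -> (forall p, p \in D -> c p.2 = i) ->
  (forall x, c x = i -> adj F (X i) x -> c (g x).2 = i) ->
  (forall d x, d \in edges F -> x \in d -> c x = i ->
     label gadget D < label gadget (g @: d) /\ [disjoint D & g @: d]) ->
  False.
Proof.
move=> gE /gadget_edgeP[j0 [d0 [d0F def_D]]] cD cgX gD.
have [x0 [y0 [_ def_d0 _]]] := edgeP d0F.
have x0d : x0 \in d0 by rewrite def_d0 set21.
have cx0 : c x0 = i.
  have /card_gt0P[p pD] : 0 < #|place j0 d0| by rewrite place_card2.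
  by rewrite -(place_c d0F x0d pD); apply: cD; rewrite def_D.
have [mF le_m] := minXY d0F x0d; rewrite cx0 in mF le_m.
set m := [set X i; Y i] in mF le_m.
have XY : X i != Y i by apply: (@adj_neq _ F).
(* Connectivity sends the tree into a single component; the neighbour [Y i] of [X i] identifies it
   as the [i]-th. *)
have cg x : c x = i -> c (g x).2 = i.
  move=> cx; have cXx : c (X i) = c x by rewrite cX.
  have step a b : predT a -> adj F a b -> predT b /\ c (g a).2 = c (g b).2.
    move=> _ /(embedding_adj gE) ab; split=> //.
    by apply: (gadget_edge_c ab); rewrite !inE eqxx ?orbT.
  have [_ <-] := path_constant (q := fun x => c (g x).2) step isT (connF cXx).
  have XYadj : adj F (X i) (Y i) by [].
  have [_ ->] := step _ _ isT XYadj; exact: cgX.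
have g_place d x : d \in edges F -> x \in d -> c x = i -> exists j d',
    [/\ d' \in edges F, g @: d = place j d', ~~ min_edge d'
      & forall y, y \in d' -> c y = i].
  move=> dF xd cx; have [/(_ d dF)/gadget_edgeP[j [d' [d'F eq_gd]]] _] := gE.
  have gxd' : g x \in place j d' by rewrite -eq_gd imset_f.
  have cd' y : y \in d' -> c y = i.
    by move=> yd'; rewrite -(place_c d'F yd' gxd') cg.
  exists j, d'; split=> //; apply/negP=> md'.
  have [i' [def_d' _ ci']] := min_edgeP d'F md'.
  have {i' ci'} def_d' : d' = m.
    by rewrite def_d' /m -[i'](cX i') -(cd' (X i')) ?cX // def_d' set21.
  have [] := gD _ _ dF xd cx.
  rewrite def_D eq_gd def_d' /= !gadget_labelE // => lt_l dis.
  (* Here [3 * l(d0) + j0 < 3 * l(m) + j] with [j < 3] and [l(m) <= l(d0)], so [D] is a triangle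
     edge too and must meet the image. *)
  have eq_d0 : d0 = m.
    apply: (label_inj d0F mF); move: (ltn_ord j) lt_l le_m; clear; lia.
  move: dis; rewrite eq_d0 !place_min // => /pred0P dis.
  have := ordS3_cover j0 j.
  case/or3P=> /eqP ej.
  - by have := dis (j0, X i); rewrite /= ej !inE eqxx.
  - by have := dis (j, X i); rewrite /= ej !inE eqxx orbT.
  - by have := dis (j0, X i); rewrite /= ej !inE !eqxx orbT.
pose E := [set d in edges F | [exists x in d, c x == i]].
have EP d : d \in E -> d \in edges F /\ exists2 x, x \in d & c x = i.
  by rewrite inE => /andP[dF /exists_inP[x xd /eqP]]; split=> //; exists x.
have mE : m \in E.
  by rewrite inE mF; apply/exists_inP; exists (X i); rewrite ?set21 ?cX.
pose j := (g (X i)).1.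
have g1 x : c x = i -> (g x).1 = j.
  move=> cx; have cXx : c (X i) = c x by rewrite cX.
  have step a b : c a == i -> adj F a b -> c b == i /\ (g a).1 = (g b).1.
    move=> /eqP ca ab; have cab := adj_c ab; split; first by rewrite -cab ca.
    have [j' [d' [d'F eq_gd nm _]]] := g_place _ a ab (set21 _ _) ca.
    have /imsetP[? _ ->] : g a \in [set (j', contract u) | u in d'].
      by rewrite -place_nonmin // -eq_gd imset_f ?set21.
    have /imsetP[? _ ->] // : g b \in [set (j', contract u) | u in d'].
    by rewrite -place_nonmin // -eq_gd imset_f ?set22.
  have cXi : c (X i) == i by rewrite cX.
  by have [_ <-] := path_constant (P := fun a => c a == i) step cXi (connF cXx).
have sub : [set g @: d | d : {set V} in E]
    \subset [set place j d | d in E :\ m].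
  apply/subsetP=> _ /imsetP[d /EP[dF [x xd cx]] ->].
  have [j' [d' [d'F eq_gd nm cd']]] := g_place d x dF xd cx.
  have ej : j' = j.
    rewrite -(g1 x cx).
    have /imsetP[? _ ->] // : g x \in [set (j', contract u) | u in d'].
    by rewrite -place_nonmin // -eq_gd imset_f.
  rewrite eq_gd ej imset_f // !inE d'F andTb; apply/andP; split.
    by apply: contraNneq nm => ->; apply: min_edge_XY.
  have [a [b [_ def_d' _]]] := edgeP d'F; apply/exists_inP; exists a.
    by rewrite def_d' set21.
  by apply/eqP/cd'; rewrite def_d' set21.
(* Since [g] need not be injective, distinctness of the images comes from strict monotonicity of
   labels. *)
have ginj : {in E &, injective (fun d : {set V} => g @: d)}.
  move=> d d' /EP[dF _] /EP[d'F _] eq_g; apply: (label_inj dF d'F).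
  have [_ glt] := gE; case: (ltngtP (label F d) (label F d')) => // lt_d.
    by have := glt _ _ dF d'F lt_d; rewrite eq_g ltnn.
  by have := glt _ _ d'F dF lt_d; rewrite eq_g ltnn.
have := subset_leq_card sub; rewrite card_in_imset //.
move/leq_trans/(_ (leq_imset_card _ _)); rewrite [#|E|](cardsD1 m) mE.
by rewrite add1n ltnn.
Qed.

Lemma gadget_free (g : V -> W) D : order_embedding F gadget g ->
  (forall d e, d \in edges F -> e \in edges F -> [disjoint d & e] ->
     [disjoint g @: d & g @: e]) ->
  D \in edges gadget ->
  (forall d, d \in edges F ->
     label gadget D < label gadget (g @: d) /\ [disjoint D & g @: d]) ->
  False.
Proof.
move=> gE gdis DG gD.
(* Induction on the number of components from [l] on. The edge [D] starts as the image of [e_0] and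
   is later replaced by images of minimal edges, so only trees of index at least [l] need to come
   after it. *)
suff H n l : k - l <= n -> forall D, D \in edges gadget ->
    (forall p, p \in D -> l <= c p.2) ->
    (forall d x, d \in edges F -> x \in d -> l <= c x ->
       label gadget D < label gadget (g @: d) /\ [disjoint D & g @: d]) ->
    False.
  by apply: (H k 0 _ D) => //; [rewrite subn0 | move=> d x dF _ _; apply: gD].
elim: n l => [|n IHn] l le_n {DG gD}D DG cD gD.
  have /card_gt0P[p pD] : 0 < #|D| by rewrite (edges_card2 DG).
  by have := cD p pD; have := ltn_ord (c p.2); lia.
have [p0 pD] : exists p, p \in D.
  by apply/card_gt0P; rewrite (edges_card2 DG).
have [lt_l|le_l] := ltnP l (c p0.2).
  apply: (IHn l.+1 _ D) => //; first by lia.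
    by move=> p /(gadget_edge_c DG pD) <-.
  by move=> d x dF xd lt_x; apply: (gD d x) => //; apply: ltnW.
have cDi p : p \in D -> c p.2 = c p0.2 by move/(gadget_edge_c DG pD).
set i := c p0.2 in le_l cDi.
have def_l : l = i by apply/eqP; rewrite eqn_leq cD.
pose m := [set X i; Y i].
have mF : m \in edges F.
  have [j [d [dF def_D]]] := gadget_edgeP DG.
  have [x [y [_ def_d _]]] := edgeP dF.
  have xd : x \in d by rewrite def_d set21.
  have [+ _] := minXY dF xd; rewrite -(@place_c j d x p0) //; by rewrite -def_D.
have gmG : g @: m \in edges gadget by case: gE => /(_ m mF).
have XXm : X i \in m by rewrite set21.
have [lt_m dis_m] : label gadget D < label gadget (g @: m) /\
    [disjoint D & g @: m].
  by apply: (gD m (X i)); rewrite ?cX ?def_l.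
have cgm p : p \in g @: m -> c p.2 = c (g (X i)).2.
  by move=> pm; apply: (gadget_edge_c gmG) => //; apply: imset_f.
(* An edge after [D] cannot lie in an earlier component of the gadget. *)
have le_q : l <= c (g (X i)).2.
  rewrite leqNgt def_l; apply/negP.
  move/(gadget_monotone gmG DG (imset_f _ XXm) pD).
  by rewrite ltnNge ltnW.
have [eq_q|lt_q] := leqP (c (g (X i)).2) l.
  have {le_q}eq_q : c (g (X i)).2 = i.
    by apply/val_inj/eqP; rewrite /= eqn_leq -def_l eq_q.
  apply: (@no_fibre_after g i D) => //.
    move=> x _ /(embedding_adj gE) adjg; rewrite -[RHS]eq_q.
    by apply: (gadget_edge_c adjg); rewrite !inE eqxx ?orbT.
  by move=> d x dF xd cx; apply: (gD d x) => //; rewrite def_l cx.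
(* The image of [m] lies in a later component and takes over the role of [D]: later trees have
   larger labels and are disjoint from [m]. *)
apply: (IHn l.+1 _ (g @: m)) => //; first by lia.
  by move=> p /cgm->.
move=> d x dF xd lt_x; split.
  case: gE => _; apply=> //; apply: (monoF mF dF XXm xd).
  by rewrite cX -def_l.
apply: gdis => //; apply/pred0P=> y /=; apply/negP=> /andP[ym yd].
by move: lt_x; rewrite (edge_c dF xd yd) (edge_c mF ym XXm) cX def_l ltnn.
Qed.

End Gadget.

(** * Copies of [e_0 + F] and transport along injections *)

Lemma e0_label_new (V : finType) (F : eograph V) :
  label (e0_plus F) (new_edge V) = 0.
Proof. by rewrite /= /add_first_label eqxx. Qed.

Lemma e0_edge_new (V : finType) (F : eograph V) :
  new_edge V \in edges (e0_plus F).
Proof. by rewrite /= setU11. Qed.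

Lemma inr_neq_new_edge (V : finType) (d : {set V}) :
  inr @: d != new_edge V.
Proof.
apply/eqP=> /setP/(_ (inl true)); rewrite !inE eqxx /=.
by move/imsetP=> [].
Qed.

Lemma e0_label_old (V : finType) (F : eograph V) (d : {set V}) :
  label (e0_plus F) (inr @: d) = (label F d).+1.
Proof.
rewrite /= /add_first_label (negbTE (inr_neq_new_edge d)) /=.
congr (label F _).+1; apply/setP=> x.
by rewrite inE mem_imset //; apply: inr_inj.
Qed.

Lemma e0_edge_old (V : finType) (F : eograph V) (d : {set V}) :
  d \in edges F -> inr @: d \in edges (e0_plus F).
Proof. by move=> dF; rewrite /= setU1r // imset_f. Qed.

Lemma e0_edgeP (V : finType) (F : eograph V) e : e \in edges (e0_plus F) ->
  e = new_edge V \/ exists2 d : {set V}, d \in edges F & e = inr @: d.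
Proof. by case/setU1P=> [|/imsetP[d dF ->]]; [left | right; exists d]. Qed.

Lemma imset_disjoint (V W : finType) (f : V -> W) (A B : {set V}) :
  injective f -> [disjoint f @: A & f @: B] = [disjoint A & B].
Proof.
by move=> f_inj; rewrite -!setI_eq0 -imsetI ?imset_eq0 //; apply: in2W.
Qed.

Section Copy.

Variables (V W W' : finType) (F : eograph V) (H : eograph W).
Variables (h : W -> W') (h_inj : injective h).

Lemma label_copy (d : {set W}) : label (copy h_inj H) (h @: d) = label H d.
Proof.
by rewrite /=; congr (label H _); apply/setP=> x; rewrite inE mem_imset.
Qed.

Lemma order_embedding_copy f : order_embedding F H f ->
  order_embedding F (copy h_inj H) (h \o f).
Proof.
move=> [fE flt]; split=> [d dF|d e dF eF lt_de].
  by rewrite imset_comp imset_f // fE.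
by rewrite (imset_comp h f d) (imset_comp h f e) (label_copy (f @: d))
  (label_copy (f @: e)); apply: flt.
Qed.

(** Pulls a copy of [e_0 + F] back along [h], with [D] the preimage of the image of [e_0].
    Preserving disjointness of edges is what remains of injectivity. *)
Lemma copy_not_contains :
  (forall (g : V -> W) D, order_embedding F H g ->
    (forall d e, d \in edges F -> e \in edges F -> [disjoint d & e] ->
       [disjoint g @: d & g @: e]) ->
    D \in edges H ->
    (forall d, d \in edges F ->
       label H D < label H (g @: d) /\ [disjoint D & g @: d]) -> False) ->
  ~ contains (copy h_inj H) (e0_plus F).
Proof.
move=> noH [f [f_inj fE flt]].
have /imsetP[D DH def_D] := fE _ (e0_edge_new F).
have /card_gt0P[w0 _] : 0 < #|D| by rewrite (edges_card2 DH).
(* The default [w0] is only reached at isolated vertices of [F]: endpoints of edges are sent into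
   the image of [h]. *)
pose g u := odflt w0 [pick w | h w == f (inr u)].
have hg d : d \in edges F -> h @: (g @: d) = f @: (inr @: d).
  move=> dF; rewrite -!imset_comp; apply: eq_in_imset => u ud /=; rewrite /g.
  case: pickP => [w /eqP //|no_w].
  have /imsetP[d1 _ def_d1] := fE _ (e0_edge_old dF).
  have : f (inr u) \in h @: d1 by rewrite -def_d1 !imset_f.
  by case/imsetP=> w _ fu; have := no_w w; rewrite fu eqxx.
have gH d : d \in edges F -> g @: d \in edges H.
  move=> dF; have /imsetP[d1 d1H] := fE _ (e0_edge_old dF).
  by rewrite -hg // => /(imset_inj h_inj)->.
apply: (noH g D) => //.
- split=> // d e dF eF lt_de.
  rewrite -(label_copy (g @: d)) -(label_copy (g @: e)) !hg //.
  by apply: flt; rewrite ?e0_edge_old // !e0_label_old ltnS.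
- move=> d e dF eF dis; rewrite -(imset_disjoint _ _ h_inj) !hg //.
  by rewrite (imset_disjoint _ _ f_inj) (imset_disjoint _ _ (@inr_inj _ _)).
move=> d dF; split.
  rewrite -(label_copy D) -(label_copy (g @: d)) hg // -def_D.
  apply: flt; rewrite ?e0_edge_new ?e0_edge_old //.
  by rewrite e0_label_new e0_label_old.
rewrite -(imset_disjoint _ _ h_inj) hg // -def_D (imset_disjoint _ _ f_inj).
apply/pred0P=> x /=; apply/negP=> /andP[xe /imsetP[u _ def_x]].
by rewrite def_x !inE in xe.
Qed.

End Copy.

Lemma label_add_first (V : finType) (G : eograph V) (e d : {set V})
    (e2 : #|e| = 2) :
  d \in edges G -> e \notin edges G ->
  label (add_first G e2) d = (label G d).+1.
Proof.
move=> dG eG; rewrite /= /add_first_label; case: eqP => // de.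
by rewrite -de dG in eG.
Qed.

Lemma order_embedding_add_first (V W : finType) (F : eograph V) (H : eograph W)
    (e : {set W}) (e2 : #|e| = 2) f :
  e \notin edges H -> order_embedding F H f ->
  order_embedding F (add_first H e2) f.
Proof.
move=> eH [fE flt]; split=> [d dF|d d' dF d'F lt_d].
  by rewrite /= setU1r // fE.
by rewrite !label_add_first ?fE // ltnS flt.
Qed.

Lemma add_first_contains (V W : finType) (F : eograph V) (H : eograph W)
    (e : {set W}) (e2 : #|e| = 2) f :
  e \notin edges H -> injective f -> order_embedding F H f ->
  (forall u, f u \notin e) -> contains (add_first H e2) (e0_plus F).
Proof.
move=> eH f_inj fE fe; have /eqP/cards2P[x [y [xy def_e]]] := e2.
pose f0 (z : bool + V) :=
  match z with inl b => if b then x else y | inr u => f u end.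
have f0new : f0 @: new_edge V = e by rewrite imsetU1 imset_set1 def_e.
have f0old (d : {set V}) : f0 @: (inr @: d) = f @: d by rewrite -imset_comp.
have [gE glt] := order_embedding_add_first e2 eH fE.
have f_xy u : (f u == x) || (f u == y) = false.
  by apply/negbTE; have := fe u; rewrite def_e !inE.
exists f0; split.
- move=> [b|u] [b'|v] /=.
  + case: b b' => [] [] // /eqP; first by rewrite (negbTE xy).
    by rewrite eq_sym (negbTE xy).
  + by move=> eq_f; have := f_xy v; case: b eq_f => <-; rewrite eqxx ?orbT.
  + by move=> eq_f; have := f_xy u; case: b' eq_f => ->; rewrite eqxx ?orbT.
  + by move/f_inj->.
- move=> _ /e0_edgeP[->|[d dF ->]]; first by rewrite f0new /= setU11.
  by rewrite f0old gE.
- have fH d : d \in edges F -> f @: d \in edges H by case: fE => + _; apply.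
  move=> _ _ /e0_edgeP[->|[d dF ->]] /e0_edgeP[->|[d' d'F ->]];
    rewrite ?e0_label_new ?e0_label_old ?f0new ?f0old ?ltnn ?ltn0 //.
    move=> _; rewrite (label_add_first _ (fH _ d'F)) //=.
    by rewrite /add_first_label eqxx.
  by rewrite ltnS => /glt; apply.
Qed.

(** * Greedy saturation inside a fixed vertex set *)

Section Greedy.

Variables (n : nat) (V : finType) (F : eograph V) (S : {set 'I_n}).

(** The set [A] may have any vertices outside [S], so a missing edge not contained in [S] can be
    taken as [A] directly. *)
Definition robust (H : eograph 'I_n) : Prop :=
  forall A : {set 'I_n}, #|A :&: S| <= 1 ->
  exists f : V -> 'I_n,
    [/\ injective f, order_embedding F H f & forall u, f u \notin A].

Lemma robust_saturate (H : eograph 'I_n) :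
  edges H \subset powerset S -> robust H -> ~ contains H (e0_plus F) ->
  exists2 H' : eograph 'I_n, saturated (e0_plus F) H' & #|edges H'| <= 2 ^ #|S|.
Proof.
have [m] := ubnP (2 ^ #|S| - #|edges H|).
elim: m H => // m IHm H lt_m HS rob noH.
have le_H : #|edges H| <= 2 ^ #|S| by rewrite -card_powerset subset_leq_card.
have [sat|nsat] := classic (saturated (e0_plus F) H); first by exists H.
have [e [e2 [eH ncon]]] : exists e : {set 'I_n}, exists e2 : #|e| = 2,
    e \notin edges H /\ ~ contains (add_first H e2) (e0_plus F).
  apply: NNPP => none; apply: nsat; split=> // e e2 eH.
  by apply: NNPP => ncon; apply: none; exists e, e2.
(* Otherwise [e] meets [S] in at most one vertex, and a copy of [F] avoiding [e] completes
   [e_0 + F]. *)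
have eS : e \subset S.
  apply: contra_notT ncon => eS.
  have [|f [f_inj fE fe]] := rob e; last exact: add_first_contains fe.
  rewrite -ltnS -e2 proper_card // properE subsetIl /=.
  by apply: contra eS => /subset_trans; apply; apply: subsetIr.
have HS' : edges (add_first H e2) \subset powerset S.
  by rewrite /= subUset sub1set inE eS.
apply: (IHm (add_first H e2)) => //.
  have := subset_leq_card HS'; rewrite card_powerset /= !cardsU1 eH add1n.
  by move: (2 ^ #|S|) #|edges H| lt_m => q r; lia.
move=> A /rob[f [f_inj fE fA]]; exists f; split=> //.
exact: order_embedding_add_first.
Qed.

End Greedy.

(** * Existence of the minimum and the final bound *)

Lemma least_nat (P : nat -> Prop) n :
  P n -> exists m, [/\ P m, m <= n & forall l, P l -> m <= l].
Proof.
elim/ltn_ind: n => n IHn Pn.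
(* Excluded middle replaces a search, as [P] need not be decidable. *)
have [[l lt_l Pl]|none] := classic (exists2 l, l < n & P l).
  have [m [Pm le_m min_m]] := IHn l lt_l Pl.
  by exists m; split=> //; apply: leq_trans le_m (ltnW lt_l).
exists n; split=> // l Pl; rewrite leqNgt; apply/negP=> lt_l.
by apply: none; exists l.
Qed.

Theorem corollary49 (V : finType) (F : eograph V) (hF : monotone_forest F) :
  exists C N : nat, forall n : nat, N <= n ->
    exists2 m : nat, sat_m n (e0_plus F) m & m <= C.
Proof.
have [k [c [hT adj_c hlt]]] := hF.
have conn := fibre_connected hT.
have acyc := fibre_acyclic hT adj_c.
have ec := edge_c adj_c.
have mono := fibre_monotone adj_c hlt.
have [XY hXY] := fin_all_exists (min_edge_exists hT adj_c).
pose X i := (XY i).1; pose Y i := (XY i).2.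
have cX i : c (X i) = i by have [] := hXY i.
have cY i : c (Y i) = i by have [] := hXY i.
have minXY d x : d \in edges F -> x \in d ->
    [set X (c x); Y (c x)] \in edges F /\
    label F [set X (c x); Y (c x)] <= label F d.
  by move=> dF xd; have [_ _ H] := hXY (c x); apply: H xd _.
pose W : finType := ('I_3 * V)%type.
pose G : eograph W := gadget conn acyc ec cX cY minXY.
(* The gadget needs [#|W|] vertices, and all edges ever used are subsets of its vertex set. *)
exists (2 ^ #|W|), #|W| => n le_n.
pose h (w : W) : 'I_n := widen_ord le_n (enum_rank w).
have h_inj : injective h.
  by move=> w w' /(congr1 val)/= /val_inj/enum_rank_inj.
pose S := h @: [set: W].
have cardS : #|S| = #|W| by rewrite card_imset // cardsT.
have [H satH le_H] : exists2 H : eograph 'I_n,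
    saturated (e0_plus F) H & #|edges H| <= 2 ^ #|S|.
  apply: (@robust_saturate _ _ _ _ (copy h_inj G)).
  - apply/subsetP=> _ /imsetP[d _ ->]; rewrite inE.
    exact/imsetS/subsetT.
  - move=> A le_A; pose A0 := h @^-1: A.
    have le_A0 : #|A0| <= 1.
      apply: leq_trans le_A; rewrite -(card_imset _ h_inj) subset_leq_card //.
      apply/subsetP=> _ /imsetP[w wA ->]; rewrite inE in wA.
      by rewrite inE wA imset_f.
    (* At most one gadget vertex is forbidden; the copy containing it is avoided, or copy 0 if there
       is none. *)
    have [j0 A0j] : exists j0, forall w, w \in A0 -> w.1 = j0.
      have [A00|/card_gt0P[w wA]] := posnP #|A0|.
        by exists ord0 => w; rewrite (cards0_eq A00) inE.
      exists w.1 => w' w'A; congr (_.1).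
      by move/card_le1P: le_A0 => /(_ w wA w'); rewrite w'A => /esym/eqP.
    have [f [f_inj fE fj]] := gadget_embedding conn acyc ec cX cY minXY j0.
    exists (h \o f); split; first exact: inj_comp.
      exact: order_embedding_copy.
    move=> u; apply/negP=> fA; case/eqP: (fj u); apply: A0j.
    by rewrite inE.
  - apply: copy_not_contains => g D gE gdis DG gD.
    exact: (gadget_free mono gE gdis DG gD).
rewrite cardS in le_H.
have [m [[H' satH' <-] le_m min_m]] :=
  least_nat (P := fun m => exists2 H : eograph 'I_n,
    saturated (e0_plus F) H & #|edges H| = m) (ex_intro2 _ _ H satH erefl).
exists #|edges H'|; last exact: leq_trans le_H.
by split=> [|K satK]; [exists H' | apply: min_m; exists K].
Qed.
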